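(* Let $p,q$ be integers with $\Delta=p^2-4q\neq 0$. Then for all $n\geq 4$, $$U_{n}^{(2)}=pU_{n-1}^{(2)}-pqU_{n-3}^{(2)}+q^{2}U_{n-4}^{(2)}\quad\text{and}\quad V_{n}^{(2)}=pV_{n-1}^{(2)}-pqV_{n-3}^{(2)}+q^{2}V_{n-4}^{(2)}.$$
   Context: For integers $p,q$, let $\Delta=p^2-4q$, $\alpha=\frac{p+\sqrt{\Delta}}{2}$, $\beta=\frac{p-\sqrt{\Delta}}{2}$, and $U_n=\frac{\alpha^n-\beta^n}{\alpha-\beta}$, $V_n=\alpha^n+\beta^n$ (so $U_0=0,U_1=1$, $V_0=2,V_1=p$, and both satisfy $W_n=pW_{n-1}-qW_{n-2}$). For $n=2m+r$ with $m\geq0$, $r\in\{0,1\}$, define $U_n^{(2)}=\frac{1}{(\alpha-\beta)^2}(\alpha^{m+1}-\beta^{m+1})^{r}(\alpha^{m}-\beta^{m})^{2-r}$ and $V_n^{(2)}=(\alpha^{m+1}+\beta^{m+1})^{r}(\alpha^{m}+\beta^{m})^{2-r}$; equivalently $U_{2m}^{(2)}=U_m^2$, $U_{2m+1}^{(2)}=U_mU_{m+1}$, $V_{2m}^{(2)}=V_m^2$, $V_{2m+1}^{(2)}=V_mV_{m+1}$. *)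

(* Defs.v *)
From mathcomp Require Import all_boot all_order all_algebra all_field.

Set Implicit Arguments.
Unset Strict Implicit.
Unset Printing Implicit Defensive.

Import Order.TTheory GRing.Theory Num.Theory.
Local Open Scope ring_scope.

Definition disc (p q : int) : int := p ^+ 2 - 4 * q.

(* The discriminant may be negative or a non-square, so the roots of
   X^2 - p X + q are taken among the complex algebraic numbers. *)
Definition alpha (p q : int) : algC :=
  (p%:~R + sqrtC (disc p q)%:~R) / 2.
Definition beta (p q : int) : algC :=
  (p%:~R - sqrtC (disc p q)%:~R) / 2.

(* The unique decomposition n = 2 m + r with r in {0, 1} is given by
   m = n./2 and r = odd n (coerced to nat). *)
Definition U2 (p q : int) (n : nat) : algC :=
  let a := alpha p q in let b := beta p q in
  let m := n./2 in let r : nat := odd n in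
  1 / (a - b) ^+ 2
  * (a ^+ m.+1 - b ^+ m.+1) ^+ r * (a ^+ m - b ^+ m) ^+ (2 - r)%N.

Definition V2 (p q : int) (n : nat) : algC :=
  let a := alpha p q in let b := beta p q in
  let m := n./2 in let r : nat := odd n in
  (a ^+ m.+1 + b ^+ m.+1) ^+ r * (a ^+ m + b ^+ m) ^+ (2 - r)%N.

(* Main.v *)
Require Import Defs.
From mathcomp Require Import all_boot all_order all_algebra all_field.
From mathcomp Require Import ring.

Set Implicit Arguments.
Unset Strict Implicit.
Unset Printing Implicit Defensive.

Import Order.TTheory GRing.Theory Num.Theory.
Local Open Scope ring_scope.

(** Both families interlace the squares [w_m ^ 2] with the products [w_m w_(m+1)] of a sequence
    obeying [w_(k+2) = p w_(k+1) - q w_k]; for [U2] there is also a constant factor, harmless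
    because the claim is linear. [interlaced_square_rec] turns the order-two recurrence into the
    order-four one, and Vieta's relations for [alpha] and [beta] supply the former. *)

Definition interlaced_square (R : comNzRingType) (w : nat -> R) (n : nat) : R :=
  w n./2.+1 ^+ odd n * w n./2 ^+ (2 - odd n)%N.

(* If [w] satisfies [w_(k+2) = p w_(k+1) - q w_k], two applications of the
   recurrence to one factor of [w_m ^ 2] or of [w_m w_(m+1)] suffice. *)
Lemma interlaced_square_rec (R : comNzRingType) (p q : R) (w : nat -> R) :
    (forall k, w k.+2 = p * w k.+1 - q * w k) ->
  forall n, interlaced_square w n.+4 =
    p * interlaced_square w n.+3 - p * q * interlaced_square w n.+1
    + q ^+ 2 * interlaced_square w n.
Proof.
move=> wS n; rewrite /interlaced_square -[n]odd_double_half.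
move: (odd n) n./2 => r m.
(* Expand the factor of higher index, then the [w_(m+2)] left in the [q] term: an odd index gives
   [w_(m+2) w_(m+3) = p w_(m+2)^2 - q w_(m+1) (p w_(m+1) - q w_m)]. *)
case: r; rewrite /= ?add0n ?add1n /= ?uphalf_double ?doubleK ?odd_double /=;
  rewrite ?subn0 ?subn1 /= ?expr0 ?expr1 ?wS; ring.
Qed.

Lemma alpha_add_beta (p q : int) : alpha p q + beta p q = p%:~R.
Proof. by rewrite /alpha /beta; field. Qed.

Lemma alpha_mul_beta (p q : int) : alpha p q * beta p q = q%:~R.
Proof.
have sqrtD : sqrtC (disc p q)%:~R ^+ 2 = p%:~R ^+ 2 - 4 * q%:~R :> algC.
  by rewrite sqrtCK /disc rmorphB rmorphXn rmorphM.
have -> : alpha p q * beta p q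
          = (p%:~R ^+ 2 - sqrtC (disc p q)%:~R ^+ 2) / 4.
  by rewrite /alpha /beta; field.
by rewrite sqrtD; field.
Qed.

Theorem theorem4 (p q : int) (hD : disc p q <> 0) (n : nat) (hn : (4 <= n)%N) :
  U2 p q n = p%:~R * U2 p q (n - 1)%N - p%:~R * q%:~R * U2 p q (n - 3)%N
             + q%:~R ^+ 2 * U2 p q (n - 4)%N
  /\
  V2 p q n = p%:~R * V2 p q (n - 1)%N - p%:~R * q%:~R * V2 p q (n - 3)%N
             + q%:~R ^+ 2 * V2 p q (n - 4)%N.
Proof.
case: n hn => [|[|[|[|n]]]] // _; rewrite !subSS !subn0.
set a := alpha p q; set b := beta p q.
have U2E k : U2 p q k
    = 1 / (a - b) ^+ 2 * interlaced_square (fun m => a ^+ m - b ^+ m) k.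
  by rewrite /interlaced_square mulrA.
have V2E k : V2 p q k = interlaced_square (fun m => a ^+ m + b ^+ m) k by [].
have recU k : a ^+ k.+2 - b ^+ k.+2
    = p%:~R * (a ^+ k.+1 - b ^+ k.+1) - q%:~R * (a ^+ k - b ^+ k).
  (* Writing [p] as [a + b] and [q] as [a * b] leaves a polynomial identity in [a], [b] and their
     [k]-th powers. *)
  by rewrite -(alpha_add_beta p q) -(alpha_mul_beta p q) -/a -/b !exprS; ring.
have recV k : a ^+ k.+2 + b ^+ k.+2
    = p%:~R * (a ^+ k.+1 + b ^+ k.+1) - q%:~R * (a ^+ k + b ^+ k).
  by rewrite -(alpha_add_beta p q) -(alpha_mul_beta p q) -/a -/b !exprS; ring.
split; last by rewrite !V2E (interlaced_square_rec recV).
rewrite !U2E (interlaced_square_rec recU).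
(* The prefactor does not depend on the index, so it becomes an opaque scalar. *)
by move: (1 / _) => c; ring.
Qed.
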